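(* Let $\mathcal P,\mathcal Q$ be two matroids on the same finite ground set $V$, and let $\mathcal D=\mathcal P\cap\mathcal Q$ (i.e. $A\in\mathcal D$ iff $A\in\mathcal P$ and $A\in\mathcal Q$). Let $n=|V|$, $\zeta=\max(\zeta(\mathcal P),\zeta(\mathcal Q))$ and $\delta_{\zeta,n}=\frac{1}{\zeta}-\frac{1}{n}$. Then for every partition $(A,B)$ of $V$ into two sets there exists a set $S\in\mathcal D$ such that $|S\cap A|\ge\lfloor\delta_{\zeta,n}|A|\rfloor-1$ and $|S\cap B|\ge\lfloor\delta_{\zeta,n}|B|\rfloor-1$.
   Context: A simplicial complex $\mathcal C$ on a ground set $V(\mathcal C)$ is a family of subsets (edges) closed under taking subsets. A matroid is a complex in which, for every subset $W$ of the ground set, all maximal edges contained in $W$ have the same size. For a complex $\mathcal C$, $\mathrm{rank}(\mathcal C)$ is the maximal size of an edge of $\mathcal C$, $\mathcal C[S]$ is the set of edges of $\mathcal C$ contained in $S$, and $\zeta(\mathcal C)=\max_{S\subseteq V(\mathcal C)}\frac{|S|}{\mathrm{rank}(\mathcal C[S])}$ (over nonempty $S$). A set $S$ represents a set $A$ almost $\alpha$-fairly if $|S\cap A|\ge\lfloor\alpha|A|\rfloor-1$; the claim says a set of $\mathcal D$ represents both parts almost $\delta_{\zeta,n}$-fairly. *)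

(* Defs.v *)
From mathcomp Require Import all_boot all_order all_algebra.
Set Implicit Arguments. Unset Strict Implicit. Unset Printing Implicit Defensive.
Import Order.TTheory GRing.Theory Num.Theory.

(* Ground set V is the whole finite type T. A complex is a family of subsets
   of T (containing the empty edge) closed under taking subsets. *)
Section Defs.
Variable T : finType.
Local Open Scope ring_scope.

Definition is_complex (C : {set {set T}}) : Prop :=
  set0 \in C /\ forall X Y : {set T}, X \in C -> Y \subset X -> Y \in C.

Definition is_matroid (C : {set {set T}}) : Prop :=
  is_complex C /\
  forall (W X Y : {set T}),
    maxset (fun Z : {set T} => (Z \in C) && (Z \subset W)) X ->
    maxset (fun Z : {set T} => (Z \in C) && (Z \subset W)) Y ->
    #|X| = #|Y|.

Definition rank (C : {set {set T}}) : nat := \max_(X in C) #|X|.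

Definition restr (C : {set {set T}}) (S : {set T}) : {set {set T}} :=
  [set X in C | X \subset S].

(* zeta(C) = max over nonempty S of |S| / rank(C[S]), valued in Q ∪ {+oo};
   None encodes +oo (some nonempty S with rank(C[S]) = 0). *)
Definition zeta (C : {set {set T}}) : option rat :=
  if [exists S : {set T}, (S != set0) && (rank (restr C S) == 0%N)] then None
  else Some (\big[Num.max/0]_(S : {set T} | S != set0)
               ((#|S|%:R : rat) / (rank (restr C S))%:R)).

Definition zeta_max (z1 z2 : option rat) : option rat :=
  match z1, z2 with
  | Some a, Some b => Some (Num.max a b)
  | _, _ => None
  end.

Definition inv_zeta (z : option rat) : rat :=
  match z with Some a => a^-1 | None => 0 end.

Definition delta (z : option rat) (n : nat) : rat := inv_zeta z - (n%:R)^-1.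

Definition almost_fair (alpha : rat) (S A : {set T}) : Prop :=
  (#|S :&: A|%:Z >= Num.floor (alpha * #|A|%:R) - 1)%R.

End Defs.

(* Main.v *)
Require Import Defs.
From mathcomp Require Import all_boot all_order all_algebra.
From mathcomp Require Import zify.

(* Let k = floor(n / zeta). Truncating P and Q to rank k, the constant vector
   k / n >= 1 / zeta - 1 / n lies in both base polytopes, so by Frank's weight
   splitting theorem there are common independent sets I, J of size k with
   |I :&: A| >= k|A| / n and |J :&: B| >= k|B| / n. Dropping one element of I,
   one can move towards J through common independent sets of size k - 1 by
   exchanging one element at a time. The size of the intersection with A changes
   by at most one at each step, so one of the sets on the way is fair to both
   sides. *)

Set Implicit Arguments. Unset Strict Implicit. Unset Printing Implicit Defensive.

(** * Rank functions of matroids, their contractions and truncations *)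

Section RankFunctions.
Variable T : finType.
Implicit Types (r : {set T} -> nat) (X Y S I U : {set T}) (w : T -> nat).

(** Matroids are handled through their rank functions, with [X] independent when [r X = #|X|].
    Contractions, truncations and families of optimal bases then all have the same form. *)
Definition rank_function r : Prop :=
  [/\ r set0 = 0,
      forall x, r [set x] <= 1,
      forall X Y, X \subset Y -> r X <= r Y
    & forall X Y, r (X :|: Y) + r (X :&: Y) <= r X + r Y].

Lemma rank_function_setU r X Y :
  rank_function r -> r (X :|: Y) <= r X + r Y.
Proof. by case=> _ _ _ /(_ X Y) sub; apply: leq_trans sub; rewrite leq_addr. Qed.

Lemma rank_function_card r X : rank_function r -> r X <= #|X|.
Proof.
move=> rr; have [r0 r1 _ _] := rr.
have [n] := ubnP #|X|; elim: n X => // n IHn X /ltnSE leXn.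
have [->|[x xX]] := set_0Vmem X; first by rewrite r0.
rewrite (cardsD1 x) xX -{1}(setD1K xX).
apply: leq_trans (rank_function_setU _ _ rr) _; rewrite leq_add ?r1 ?IHn //.
by move: leXn; rewrite (cardsD1 x X) xX.
Qed.

Lemma rank_function_contract r s :
  rank_function r -> rank_function (fun X => r (s |: X) - r [set s]).
Proof.
move=> rr; have [r0 r1 mono sub] := rr.
split.
- by rewrite setU0 subnn.
- by move=> x /=; have := rank_function_setU [set s] [set x] rr; have := r1 x; lia.
- by move=> X Y sXY; apply/leq_sub2r/mono/setUS.
move=> X Y /=; have := sub (s |: X) (s |: Y).
rewrite -setUUr -setUIr.
have gt X' : r [set s] <= r (s |: X') by apply: mono; apply: subsetUl.
by have := gt X; have := gt Y; have := gt (X :|: Y); have := gt (X :&: Y); lia.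
Qed.

Lemma rank_function_truncate r k :
  rank_function r -> rank_function (fun X => minn (r X) k).
Proof.
case=> r0 r1 mono sub; split.
- by rewrite r0 min0n.
- by move=> x /=; have := r1 x; lia.
- by move=> X Y /mono /=; lia.
move=> X Y /=; have := sub X Y.
have := mono _ _ (subsetIl X Y); have := mono _ _ (subsetIr X Y).
by have := mono _ _ (subsetUl X Y); have := mono _ _ (subsetUr X Y); lia.
Qed.

(** * Edmonds's matroid intersection theorem *)

(** Induction on [#|S|]: deleting [s] and contracting [s] give two covers [A] and [B], which are
    uncrossed by submodularity. *)
Lemma matroid_intersection r1 r2 S : rank_function r1 -> rank_function r2 ->
  exists I U : {set T}, [/\ I \subset S, U \subset S, r1 I = #|I|, r2 I = #|I|
                & r1 U + r2 (S :\: U) <= #|I|].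
Proof.
have [n] := ubnP #|S|; elim: n S r1 r2 => // n IHn S r1 r2 /ltnSE leSn rr1 rr2.
have [-> | [s sS]] := set_0Vmem S.
  exists set0, set0; rewrite setD0 cards0 !sub0set.
  by have [-> _ _ _] := rr1; have [-> _ _ _] := rr2.
have ltS : #|S :\ s| < n by move: leSn; rewrite (cardsD1 s) sS.
have [I [A [sIS sAS I1 I2 leA]]] := IHn _ _ _ ltS rr1 rr2.
have sSS : S :\ s \subset S by rewrite subsetDl.
have sA : s \notin A by apply/negP => /(subsetP sAS); rewrite !inE eqxx.
have [_ le11 mono1 sub1] := rr1; have [_ le12 mono2 sub2] := rr2.
(* A loop of [r1] or of [r2] joins the side of the cover where it costs nothing. *)
have [r1s | r1s] := posnP (r1 [set s]).
  exists I, (s |: A); split=> //; first exact: subset_trans sSS.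
    by rewrite subUset sub1set sS (subset_trans sAS).
  have := rank_function_setU [set s] A rr1; rewrite r1s.
  suff -> : S :\: (s |: A) = (S :\ s) :\: A by lia.
  by apply/setP => x; rewrite !inE; case: (x == s); case: (x \in A).
have [r2s | r2s] := posnP (r2 [set s]).
  exists I, A; split=> //; try exact: subset_trans sSS.
  have := rank_function_setU [set s] ((S :\ s) :\: A) rr2; rewrite r2s.
  suff -> : s |: ((S :\ s) :\: A) = S :\: A by lia.
  by apply/setP => x; rewrite !inE; case: eqP => [->|]; rewrite ?sS ?sA.
have {r1s} r1s : r1 [set s] = 1 by have := le11 s; lia.
have {r2s} r2s : r2 [set s] = 1 by have := le12 s; lia.
have [I' [B [sI'S sBS I'1 I'2 leB]]] := IHn _ _ _ ltS
  (rank_function_contract s rr1) (rank_function_contract s rr2).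
have sB : s \notin B by apply/negP => /(subsetP sBS); rewrite !inE eqxx.
have sI' : s \notin I' by apply/negP => /(subsetP sI'S); rewrite !inE eqxx.
have cI' : #|s |: I'| = #|I'|.+1 by rewrite cardsU1 sI'.
have ge1 X : 0 < r1 (s |: X) by rewrite -r1s; apply/mono1/subsetUl.
have ge2 X : 0 < r2 (s |: X) by rewrite -r2s; apply/mono2/subsetUl.
rewrite r1s in I'1 leB; rewrite r2s in I'2 leB.
(* [J] is the larger of [I] and [s |: I']. *)
have [J [sJS J1 J2 leIJ leI'J]] : exists J : {set T}, [/\ J \subset S, r1 J = #|J|,
    r2 J = #|J|, #|I| <= #|J| & #|I'| < #|J|].
  have [ltII' | leI'I] := leqP #|I| #|I'|.
    exists (s |: I'); rewrite cI' ltnS (leqW ltII'); split=> //.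
    - by rewrite subUset sub1set sS (subset_trans sI'S).
    - by rewrite -I'1 subn1 prednK ?ge1.
    - by rewrite -I'2 subn1 prednK ?ge2.
  by exists I; split=> //; apply: subset_trans sSS.
(* The covers given by [A :&: B] and [s |: (A :|: B)] have total value at most [#|I| + #|I'| + 2],
   which is below [2 * #|J| + 2]; so one of them has value at most [#|J|]. *)
have := sub1 A (s |: B); have := sub2 ((S :\ s) :\: A) (s |: ((S :\ s) :\: B)).
have -> : A :|: (s |: B) = s |: (A :|: B) by rewrite setUCA.
have -> : A :&: (s |: B) = A :&: B.
  by apply/setP => x; rewrite !inE; case: eqP => [->|]; rewrite ?(negPf sA).
have -> : ((S :\ s) :\: A) :|: (s |: ((S :\ s) :\: B)) = S :\: (A :&: B).
  apply/setP => x; rewrite !inE; case: eqP => [->|] /=.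
    by rewrite sS (negPf sA) andbF.
  by case: (x \in A); case: (x \in B); case: (x \in S).
have -> : ((S :\ s) :\: A) :&: (s |: ((S :\ s) :\: B)) = S :\: (s |: (A :|: B)).
  apply/setP => x; rewrite !inE; case: eqP => [->|] /=; first by rewrite !andbF.
  by case: (x \in A); case: (x \in B); case: (x \in S).
move=> H2 H1.
have gt1 := ge1 B; have gt2 := ge2 ((S :\ s) :\: B).
have [leU | ltU] := leqP (r1 (A :&: B) + r2 (S :\: (A :&: B))) #|J|.
  exists J, (A :&: B); split=> //.
  exact: subset_trans (subsetIl _ _) (subset_trans sAS sSS).
exists J, (s |: (A :|: B)); split=> //; last first.
  by clear -leA leB leIJ leI'J H1 H2 ltU gt1 gt2; lia.
by rewrite !subUset sub1set sS (subset_trans sAS) // (subset_trans sBS).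
Qed.

(** * Lovász extension and weight splitting *)

(* The Lovász extension of [r], for weights bounded by [N]; it is the maximal
   [w]-weight of a basis. *)
Definition lovasz N r w := \sum_(0 <= c < N) r [set x | c < w x].

Definition bump_on X w x := w x + (x \in X).

Lemma lovasz_widen N r w : rank_function r -> (forall x, w x <= N) ->
  lovasz N.+1 r w = lovasz N r w.
Proof.
case=> r0 _ _ _ wN; rewrite /lovasz big_nat_recr //= [X in r X](_ : _ = set0).
  by rewrite r0 addn0.
by apply/setP => x; rewrite !inE ltnNge wN.
Qed.

Lemma lovasz_bump_ge N r X w : rank_function r ->
  lovasz N r w <= lovasz N r (bump_on X w).
Proof.
case=> _ _ mono _; apply: leq_sum => c _; apply/mono/subsetP => x.
by rewrite !inE /bump_on; lia.
Qed.

(* Independent sets of this rank function of size [r setT] are the maximal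
   [w]-weight bases. *)
Lemma rank_function_lovasz N r w : rank_function r ->
  rank_function (fun X => lovasz N r (bump_on X w) - lovasz N r w).
Proof.
move=> rr; have [r0 r1 mono sub] := rr.
have le X := lovasz_bump_ge N X w rr.
have mon X Y : X \subset Y -> lovasz N r (bump_on X w) <= lovasz N r (bump_on Y w).
  move=> /subsetP sXY; apply: leq_sum => c _; apply/mono/subsetP => x.
  rewrite !inE /bump_on => /leq_trans-> //; rewrite leq_add2l.
  by case: (x \in X) (sXY x) => // ->.
split.
- suff -> : lovasz N r (bump_on set0 w) = lovasz N r w by rewrite subnn.
  apply: eq_bigr => c _; congr r; apply/setP => x.
  by rewrite !inE /bump_on inE addn0.
- move=> x; rewrite leq_subLR /lovasz.
  (* Bumping the single point [x] changes only the level [c = w x], by at most one. *)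
  apply: (@leq_trans (\sum_(0 <= c < N) (r [set y | c < w y] + (c == w x)))).
    apply: leq_sum => c _.
    have [-> | ne_c] := eqVneq c (w x).
      apply: leq_trans (leq_add (leqnn _) (r1 x)).
      apply: leq_trans (rank_function_setU _ _ rr); apply/mono/subsetP => y.
      by rewrite !inE /bump_on inE; case: eqP => //; lia.
    rewrite addn0; apply/mono/subsetP => y; rewrite !inE /bump_on inE.
    by case: eqP => [->|]; lia.
  rewrite big_split /= leq_add2l.
  rewrite (eq_bigr (fun c => if c == w x then 1 else 0)); last by move=> c _; case: eqP.
  by rewrite -big_mkcond big_nat1_eq; case: ifP.
- by move=> X Y sXY; rewrite leq_sub2r ?mon.
move=> X Y.
have : lovasz N r (bump_on (X :|: Y) w) + lovasz N r (bump_on (X :&: Y) w)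
    <= lovasz N r (bump_on X w) + lovasz N r (bump_on Y w).
  rewrite /lovasz -!big_split; apply: leq_sum => c _ /=.
  apply: leq_trans (sub _ _); rewrite leq_add // mono //; apply/subsetP => x;
    by rewrite !inE /bump_on !inE; case: (x \in X); case: (x \in Y); lia.
by have := le X; have := le Y; have := le (X :|: Y); have := le (X :&: Y); lia.
Qed.

(* When [I] is a basis for the rank function above, [c = 0] makes it independent
   for [r], and general [c] makes [I :&: [set x | c <= w x]] span its level. *)
Lemma lovasz_bump_le N r w I c : rank_function r -> (forall x, w x < N) ->
    c <= N ->
  lovasz N r (bump_on I w) + r [set x | c <= w x]
    <= lovasz N r w + r setT + r (I :&: [set x | c <= w x]).
Proof.
move=> rr wN cN; have [r0 _ mono sub] := rr.
(* Below [c], each level of the bumped weight lies in the previous level of [w], and the sum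
   telescopes. *)
have low d : \sum_(0 <= j < d) r [set x | j < bump_on I w x] + r [set x | d <= w x]
    <= \sum_(0 <= j < d) r [set x | j < w x] + r setT.
  elim: d => [|d IHd]; first by rewrite !big_geq // leq_add2l mono ?subsetT.
  rewrite !big_nat_recr //=.
  have : r [set x | d < bump_on I w x] <= r [set x | d <= w x].
    by apply/mono/subsetP => x; rewrite !inE /bump_on; lia.
  by move: IHd; lia.
(* From [c] on, submodularity at each level makes the ranks of [I :&: [set x | d <= w x]]
   telescope. *)
have high d : c <= d -> \sum_(c <= j < d) r [set x | j < bump_on I w x]
      + r (I :&: [set x | d <= w x])
    <= \sum_(c <= j < d) r [set x | j < w x] + r (I :&: [set x | c <= w x]).
  move=> /subnKC <-; elim: (d - c) => [|e IHe].
    by rewrite addn0 !big_geq.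
  rewrite addnS !big_nat_recr ?leq_addr //=.
  have := sub [set x | c + e < w x] (I :&: [set x | c + e <= w x]).
  have -> : [set x | c + e < w x] :|: (I :&: [set x | c + e <= w x])
      = [set x | c + e < bump_on I w x].
    by apply/setP => x; rewrite !inE /bump_on; case: (x \in I) => /=; lia.
  have -> : [set x | c + e < w x] :&: (I :&: [set x | c + e <= w x])
      = I :&: [set x | c + e < w x].
    by apply/setP => x; rewrite !inE; case: (x \in I) => /=; lia.
  by move: IHe; lia.
have := high _ cN; have := low c.
have cut (F : nat -> nat) : \sum_(0 <= j < N) F j
    = \sum_(0 <= j < c) F j + \sum_(c <= j < N) F j by apply: big_cat_nat.
have -> : I :&: [set x | N <= w x] = set0.
  by apply/setP => x; rewrite !inE leqNgt wN andbF.
by rewrite /lovasz !cut r0; lia.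
Qed.

Lemma sum_layers N w X : (forall x, w x <= N) ->
  \sum_(x in X) w x = \sum_(0 <= c < N) #|X :&: [set x | c < w x]|.
Proof.
move=> wN.
have layer c : #|X :&: [set x | c < w x]| = \sum_(x in X) (c < w x).
  rewrite -sum1_card (eq_bigl (fun x => (x \in X) && (c < w x))) ?big_mkcondr.
    by apply: eq_bigr => x _; case: (_ < _).
  by move=> x; rewrite !inE.
rewrite (eq_bigr _ (fun c _ => layer c)) exchange_big /=; apply: eq_bigr => x _.
move: (w x) (wN x) => v vN.
rewrite (@big_cat_nat _ _ _ v) //= (@eq_big_nat _ _ _ 0 v _ (fun=> 1)); last first.
  by move=> c /andP[_ ->].
rewrite (@eq_big_nat _ _ _ v N _ (fun=> 0)); last first.
  by move=> c /andP[vc _]; rewrite ltnNge vc.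
by rewrite !sum_nat_const_nat muln1 subn0 muln0 addn0.
Qed.

(** An increment of [k], at least [r setT], leaves no slack in [lovasz_bump_le]: [I] spans every
    upper level of [w], and counting by levels bounds its weight. *)
Lemma optimal_basis N r w k I : rank_function r -> (forall x, w x < N) ->
    r setT <= k -> #|I| = k ->
    lovasz N r (bump_on I w) - lovasz N r w = k ->
  r I = #|I| /\ lovasz N r w <= \sum_(x in I) w x.
Proof.
move=> rr wN rk Ik lk.
have key c : c <= N -> r [set x | c <= w x] <= r (I :&: [set x | c <= w x]).
  by move=> cN; have := lovasz_bump_le I rr wN cN; have := lovasz_bump_ge N I w rr; lia.
split.
  have := lovasz_bump_le I rr wN (leq0n N).
  have -> : [set x | 0 <= w x] = setT by apply/setP => x; rewrite !inE.
  by rewrite setIT; have := rank_function_card I rr; lia.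
rewrite (sum_layers _ (fun x => ltnW (wN x))) /lovasz !big_nat.
apply: leq_sum => c /andP[_ cN].
exact: leq_trans (key c.+1 cN) (rank_function_card _ rr).
Qed.

(** The constant vector [k / #|T|] satisfies all rank constraints, so its [w]-weight is at most that
    of the best basis; this is summed level by level. *)
Lemma lovasz_ge N r w k : (forall x, w x <= N) ->
    (forall X, k * #|X| <= #|T| * r X) ->
  k * (\sum_x w x) <= #|T| * lovasz N r w.
Proof.
move=> wN rk.
have -> : \sum_x w x = \sum_(x in setT) w x by apply: eq_bigl => x; rewrite inE.
rewrite (sum_layers _ wN) /lovasz !big_distrr /=; apply: leq_sum => c _.
by rewrite setTI.
Qed.

(* [w1 + w2] stays equal to the indicator of [A] plus a
   constant [M]. If no common basis is optimal for both, the set [U] of the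
   matroid intersection theorem for the two families of optimal bases tells
   how to shift the splitting so that its value decreases. *)
Lemma weight_splitting r1 r2 k (A : {set T}) N M w1 w2 : 0 < #|T| ->
    rank_function r1 -> rank_function r2 ->
    r1 setT <= k -> r2 setT <= k ->
    (forall X, k * #|X| <= #|T| * r1 X) ->
    (forall X, k * #|X| <= #|T| * r2 X) ->
    (forall x, w1 x <= N) -> (forall x, w2 x <= N) ->
    (forall x, w1 x + w2 x = M + (x \in A)) ->
  exists I, [/\ r1 I = #|I|, r2 I = #|I|, #|I| = k
              & k * #|A| <= #|T| * #|I :&: A|].
Proof.
move=> T_gt0 rr1 rr2 r1k r2k kr1 kr2.
have sum_split X M' (v1 v2 : T -> nat) : (forall x, v1 x + v2 x = M' + (x \in A)) ->
    \sum_(x in X) v1 x + \sum_(x in X) v2 x = M' * #|X| + #|X :&: A|.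
  move=> v12; rewrite -big_split /= (eq_bigr _ (fun x _ => v12 x)) big_split /=.
  rewrite sum_nat_const mulnC -[#|X :&: A|]sum1_card; congr (_ + _).
  rewrite [RHS](eq_bigl (fun x => (x \in X) && (x \in A))) => [|x]; last by rewrite inE.
  by rewrite big_mkcondr; apply: eq_bigr => x _; case: (_ \in _).
have lower N' M' (v1 v2 : T -> nat) : (forall x, v1 x <= N') -> (forall x, v2 x <= N') ->
    (forall x, v1 x + v2 x = M' + (x \in A)) ->
    k * (M' * #|T| + #|A|) <= #|T| * (lovasz N' r1 v1 + lovasz N' r2 v2).
  move=> v1N v2N v12; have := sum_split setT _ _ _ v12.
  rewrite cardsT setTI => <-; rewrite !mulnDr leq_add //.
    by under eq_bigl => x do rewrite inE; apply: lovasz_ge.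
  by under eq_bigl => x do rewrite inE; apply: lovasz_ge.
have swap m : #|T| * (m * k) = k * (m * #|T|) by rewrite mulnCA [#|T| * k]mulnC mulnCA.
(* A shift raises [M] by one and the value by less than [k], so this difference drops. *)
have [d] := ubnP (lovasz N r1 w1 + lovasz N r2 w2 - M * k).
elim: d N M w1 w2 => // d IHd N M w1 w2 /ltnSE led w1N w2N w12.
(* Bumped weights can reach [N.+1], so [N.+1] levels are counted. *)
have [I [U [_ _ I1 I2 leU]]] := matroid_intersection setT
  (rank_function_lovasz N.+1 w1 rr1) (rank_function_lovasz N.+1 w2 rr2).
have [leIk | ltIk] := leqP k #|I|.
  have Ik : #|I| = k.
    have := lovasz_bump_le I rr1 (fun x => w1N x : w1 x < N.+1) (leq0n _).
    have -> : [set x | 0 <= w1 x] = setT by apply/setP => x; rewrite !inE.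
    have [_ _ mono1 _] := rr1.
    by have := lovasz_bump_ge N.+1 I w1 rr1; move: I1; rewrite setIT; have := mono1 _ _ (subsetT I); lia.
  have [I1' le1] := optimal_basis rr1 (fun x => w1N x : w1 x < N.+1) r1k Ik (etrans I1 Ik).
  have [I2' le2] := optimal_basis rr2 (fun x => w2N x : w2 x < N.+1) r2k Ik (etrans I2 Ik).
  exists I; split=> //.
  (* Optimality of [I] for both weights meets the lower bound; the terms in [M] cancel. *)
  have := lower _ _ _ _ w1N w2N w12; have := sum_split I _ _ _ w12.
  move: le1 le2; rewrite Ik (lovasz_widen rr1 w1N) (lovasz_widen rr2 w2N) => le1 le2 eqI low.
  have : #|T| * (lovasz N r1 w1 + lovasz N r2 w2) <= #|T| * (M * k + #|I :&: A|).
    by rewrite leq_mul2l -eqI leq_add ?orbT.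
  by move/(leq_trans low); rewrite !mulnDr swap leq_add2l.
have b1 x : bump_on U w1 x <= N.+1 by have := w1N x; rewrite /bump_on; lia.
have b2 x : bump_on (~: U) w2 x <= N.+1 by have := w2N x; rewrite /bump_on; lia.
have b12 x : bump_on U w1 x + bump_on (~: U) w2 x = M.+1 + (x \in A).
  by have := w12 x; rewrite /bump_on inE; case: (x \in U) => /=; lia.
apply: (IHd N.+1 M.+1 (bump_on U w1) (bump_on (~: U) w2)) => //.
have := lovasz_bump_ge N.+1 U w1 rr1; have := lovasz_bump_ge N.+1 (~: U) w2 rr2.
move: leU; rewrite setTD (lovasz_widen rr1 w1N) (lovasz_widen rr2 w2N) => leU ge2 ge1.
(* With this bound the natural subtraction in the measure does not truncate. *)
suff : M.+1 * k <= lovasz N.+1 r1 (bump_on U w1) + lovasz N.+1 r2 (bump_on (~: U) w2).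
  by move: led leU ltIk; rewrite mulSn; lia.
rewrite -(leq_pmul2l T_gt0); apply: leq_trans (lower _ _ _ _ b1 b2 b12).
by rewrite mulnDr swap leq_addr.
Qed.

End RankFunctions.

(** * Matroid ranks, exchange and fair common independent sets *)

Section Matroids.
Variable T : finType.
Implicit Types (C P Q : {set {set T}}) (X Y S I J A : {set T}).

Lemma card_le_rank C S X : X \in C -> X \subset S -> #|X| <= rank (restr C S).
Proof.
by move=> CX sXS; apply: (@leq_bigmax_cond _ _ (fun X : {set T} => #|X|)); rewrite inE CX.
Qed.

Lemma rank_attained C S : set0 \in C ->
  exists X, [/\ X \in C, X \subset S & #|X| = rank (restr C S)].
Proof.
move=> C0; have r0 : 0 < #|restr C S|.
  by apply/card_gt0P; exists set0; rewrite inE C0 sub0set.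
have [X] := eq_bigmax_cond (fun X : {set T} => #|X|) r0.
by rewrite inE => /andP[CX sXS] eqX; exists X.
Qed.

Lemma matroid_extend C S X : is_matroid C -> X \in C -> X \subset S ->
  exists Z, [/\ Z \in C, X \subset Z, Z \subset S & #|Z| = rank (restr C S)].
Proof.
move=> [[C0 _] Cmax] CX sXS.
pose indep Z := (Z \in C) && (Z \subset S).
have [Z Zmax sXZ] := @maxset_exists _ indep X (introT andP (conj CX sXS)).
have [Y [CY sYS cardY]] := rank_attained S C0.
have [Y' Ymax sYY'] := @maxset_exists _ indep Y (introT andP (conj CY sYS)).
have /andP[CZ sZS] := maxsetp Zmax; have /andP[CY' sY'S] := maxsetp Ymax.
exists Z; split=> //; apply/eqP; rewrite eqn_leq card_le_rank //=.
by rewrite (Cmax _ _ _ Zmax Ymax) -cardY subset_leq_card.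
Qed.

Lemma matroid_rank_function C : is_matroid C ->
  rank_function (fun S => rank (restr C S)).
Proof.
move=> mC; have [[C0 Csub] _] := mC.
have le_card S : rank (restr C S) <= #|S|.
  by have [X [_ sXS <-]] := rank_attained S C0; apply: subset_leq_card.
split.
- by apply/eqP; rewrite -leqn0 -(cards0 T).
- by move=> x; rewrite -(cards1 x).
- move=> X Y sXY; have [Z [CZ sZX <-]] := rank_attained X C0.
  exact: card_le_rank CZ (subset_trans sZX sXY).
(* Submodularity: a basis [I] of [X :&: Y] extends to a basis [J] of [X :|: Y], whose traces on [X]
   and [Y] are counted. *)
move=> X Y; have [I [CI sI cardI]] := rank_attained (X :&: Y) C0.
have sXYU : X :&: Y \subset X :|: Y := subset_trans (subsetIl X Y) (subsetUl X Y).
have [J [CJ sIJ sJ <-]] := matroid_extend mC CI (subset_trans sI sXYU).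
have le Z : #|J :&: Z| <= rank (restr C Z).
  by apply: card_le_rank (subsetIr _ _); apply: Csub CJ (subsetIl _ _).
have := le X; have := le Y; rewrite -cardI.
have := cardsUI (J :&: X) (J :&: Y); rewrite -setIUr (setIidPl sJ).
have : #|I| <= #|J :&: X :&: (J :&: Y)|.
  by apply: subset_leq_card; rewrite -setIIr subsetI sIJ.
lia.
Qed.

Lemma rank_card_indep C X : is_matroid C -> rank (restr C X) = #|X| -> X \in C.
Proof.
move=> [[C0 _] _] rX; have [Y [CY sYX cardY]] := rank_attained X C0.
suff <- : Y = X by [].
by apply/eqP; rewrite eqEcard sYX cardY rX leqnn.
Qed.

(** Extending [I] to a basis of [I :|: J] reaches size at least [#|J|], hence adds a point of
    [J]. *)
Lemma matroid_augment C I J : is_matroid C -> I \in C -> J \in C ->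
  #|I| < #|J| -> exists2 j, j \in J :\: I & j |: I \in C.
Proof.
move=> mC CI CJ ltIJ; have [[_ Csub] _] := mC.
have [Z [CZ sIZ sZ cardZ]] := matroid_extend mC CI (subsetUl I J).
have /subsetPn[j jZ jI] : ~~ (Z \subset I).
  apply/negP => /subset_leq_card; rewrite leqNgt => /negP; apply.
  by rewrite cardZ (leq_trans ltIJ) // card_le_rank ?subsetUr.
exists j; first by have := subsetP sZ j jZ; rewrite !inE (negPf jI).
by apply: Csub CZ _; rewrite subUset sub1set jZ.
Qed.

(* Augment [I] in [P] by an element [j] of [J]; the circuit this may close in
   [Q] contains an element outside [J], whose removal gives the new set. *)
Lemma swap_towards P Q I J : is_matroid P -> is_matroid Q ->
    I \in P :&: Q -> J \in P :&: Q -> #|J| = #|I|.+1 ->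
  (exists j, J = j |: I) \/ exists j I', [/\ j \in J :\: I, I' \in P :&: Q, #|I'| = #|I|,
       I' \subset j |: I & j |: (I :&: J) \subset I'].
Proof.
move=> mP mQ /setIP[PI QI] /setIP[PJ QJ] cardJ.
have [[_ Psub] _] := mP; have [[_ Qsub] _] := mQ.
have [j jJI PjI] : exists2 j, j \in J :\: I & j |: I \in P.
  by apply: matroid_augment; rewrite ?cardJ.
have [jJ jI] : j \in J /\ j \notin I by move: jJI; rewrite inE => /andP[].
have sKJ : j |: (I :&: J) \subset J by rewrite subUset sub1set jJ subsetIr.
(* Growing [Z] from [j |: (I :&: J)] ensures that only points of [I] outside [J] can be lost. *)
have [Z [QZ sKZ sZ cardZ]] := matroid_extend mQ (Qsub _ _ QJ sKJ) (setUS [set j] (subsetIl I J)).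
have leIZ : #|I| <= #|Z| by rewrite cardZ card_le_rank ?subsetUr.
have leZ : #|Z| <= #|I|.+1.
  by have := subset_leq_card sZ; rewrite cardsU1 jI.
have PZ : Z \in P := Psub _ _ PjI sZ.
have [eqZ | neZ] := eqVneq #|Z| #|I|.
  by right; exists j, Z; split=> //; rewrite inE PZ.
have cZ : #|Z| = #|I|.+1.
  by apply/eqP; rewrite eqn_leq leZ ltn_neqAle eq_sym neZ.
have eqZ : Z = j |: I by apply/eqP; rewrite eqEcard sZ cardsU1 jI cZ add1n leqnn.
have [sZJ | /subsetPn[i iZ iJ]] := boolP (Z \subset J).
  left; exists j; rewrite -eqZ.
  by apply/esym/eqP; rewrite eqEcard sZJ cardJ cZ leqnn.
right; exists j, (Z :\ i).
have sub : Z :\ i \subset Z by apply: subsetDl.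
split=> //.
- by rewrite inE (Psub _ _ PZ sub) (Qsub _ _ QZ sub).
- by have := cardsD1 i Z; rewrite iZ cZ add1n => -[].
- exact: subset_trans sub sZ.
- by rewrite subsetD1 sKZ; apply: contra iJ => /(subsetP sKJ).
Qed.

(** Each swap shrinks [J :\: I] and lowers [#|I :&: A|] by at most one, so the value [m] is not
    skipped. *)
Lemma common_indep_interpolation P Q A I J m : is_matroid P -> is_matroid Q ->
    I \in P :&: Q -> J \in P :&: Q -> #|J| = #|I|.+1 ->
    #|J :&: A| <= m <= #|I :&: A| ->
  exists S, [/\ S \in P :&: Q, #|S| = #|I| & #|S :&: A| = m].
Proof.
move=> mP mQ; have [d] := ubnP #|J :\: I|.
elim: d I => // d IHd I /ltnSE led DI DJ cardJ /andP[leJm leIm].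
have [eqI | neI] := eqVneq #|I :&: A| m; first by exists I.
have ltm : m < #|I :&: A| by lia.
have [[j eqJ] | [j [I' [jJI DI' cardI' sI' sI'J]]]] :=
  swap_towards mP mQ DI DJ cardJ.
  have : #|I :&: A| <= #|J :&: A| by apply/subset_leq_card/setSI; rewrite eqJ subsetUr.
  lia.
rewrite -cardI'; apply: IHd => //; last first.
- rewrite leJm /= -ltnS (leq_trans ltm) //.
  have ltDD : #|I :\: I'| <= 1.
    have -> : #|I :\: I'| = #|I' :\: I|.
      by have := cardsID I' I; have := cardsID I I'; rewrite setIC cardI'; lia.
    by rewrite -(cards1 j) subset_leq_card // subDset setUC.
  have sIA : I :&: A \subset (I' :&: A) :|: (I :\: I').
    by apply/subsetP => x; rewrite !inE; case: (x \in I'); case: (x \in I); case: (x \in A).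
  have := subset_leq_card sIA; have := (cardsUI (I' :&: A) (I :\: I')); lia.
- by rewrite cardI'.
apply: leq_trans led; move: jJI; rewrite inE => /andP[jI jJ].
apply/proper_card/properP; split.
  apply/subsetP => x; rewrite !inE => /andP[xI' xJ]; rewrite xJ andbT.
  by apply: contra xI' => xI; apply: (subsetP sI'J); rewrite !inE xI xJ orbT.
exists j; rewrite !inE jJ ?jI // andbT negbK.
by apply: (subsetP sI'J); rewrite !inE eqxx.
Qed.

Lemma weighted_common_basis P Q A k : is_matroid P -> is_matroid Q ->
    0 < #|T| ->
    (forall X, k * #|X| <= #|T| * rank (restr P X)) ->
    (forall X, k * #|X| <= #|T| * rank (restr Q X)) ->
  exists I, [/\ I \in P :&: Q, #|I| = k & k * #|A| <= #|T| * #|I :&: A|].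
Proof.
move=> mP mQ T_gt0 kP kQ.
have rP := matroid_rank_function mP; have rQ := matroid_rank_function mQ.
(* Truncation at [k] keeps the rank inequality because [#|X| <= #|T|]. *)
have trunc C X : k * #|X| <= #|T| * rank (restr C X) ->
    k * #|X| <= #|T| * minn (rank (restr C X)) k.
  by move=> kC; rewrite minnMr leq_min kC mulnC leq_mul2r max_card orbT.
(* The initial splitting puts the indicator of [A] on [P] and zero on [Q], with [M = 0]. *)
have w1_le x : (x \in A : nat) <= 1 by case: (x \in A).
have w12 x : (x \in A : nat) + 0 = 0 + (x \in A) by rewrite addn0.
have [I [IP IQ cardI kA]] := weight_splitting T_gt0
  (rank_function_truncate k rP) (rank_function_truncate k rQ)
  (geq_minr _ _) (geq_minr _ _) (fun X => trunc _ _ (kP X)) (fun X => trunc _ _ (kQ X))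
  w1_le (fun=> leq0n 1) w12.
exists I; split=> //; rewrite inE; apply/andP; split; apply: rank_card_indep => //.
  by have := rank_function_card I rP; lia.
by have := rank_function_card I rQ; lia.
Qed.

Lemma fair_common_indep P Q A B k : is_matroid P -> is_matroid Q ->
    A :&: B = set0 -> A :|: B = [set: T] ->
    (forall X, k * #|X| <= #|T| * rank (restr P X)) ->
    (forall X, k * #|X| <= #|T| * rank (restr Q X)) ->
  exists2 S, S \in P :&: Q & k * #|A| %/ #|T| <= #|S :&: A|.+1
                          /\ k * #|B| %/ #|T| <= #|S :&: B|.+1.
Proof.
move=> mP mQ AB0 ABT kP kQ.
have [[[P0 Psub] _] [[Q0 Qsub] _]] := (mP, mQ).
have [T0 | T_gt0] := posnP #|T|.
  by exists set0; rewrite ?inE ?P0 // T0 !divn0.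
have cardAB S : #|S| = #|S :&: A| + #|S :&: B|.
  by rewrite -cardsUI -setIUr ABT setIT -setIIr AB0 setI0 cards0 addn0.
set x := _ %/ _; set y := _ %/ _.
have [I [DI cardI kA]] := weighted_common_basis A mP mQ T_gt0 kP kQ.
have [J [DJ cardJ kB]] := weighted_common_basis B mP mQ T_gt0 kP kQ.
have lex : x <= #|I :&: A| by rewrite -(mulKn #|I :&: A| T_gt0) leq_div2r.
have ley : y <= #|J :&: B| by rewrite -(mulKn #|J :&: B| T_gt0) leq_div2r.
have lexy : x + y <= k.
  rewrite -(leq_pmul2r T_gt0) mulnDl.
  rewrite (leq_trans (leq_add (leq_trunc_div _ _) (leq_trunc_div _ _))) // -mulnDr.
  by have := cardAB setT; rewrite !setTI cardsT => <-.
have [leJ | ltJ] := leqP x #|J :&: A|.+1; first by exists J => //; split=> //; apply: leqW.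
have [i iI] : exists i, i \in I.
  by apply/set0Pn; rewrite -card_gt0 (cardAB I); lia.
have sI : I :\ i \subset I by apply: subsetDl.
have cI : #|I :\ i|.+1 = k by rewrite -cardI (cardsD1 i I) iI.
(* Aiming at [x.-1] in [A] leaves [k - x >= y] points in [B], as [#|S| = k - 1]. *)
have [|||S [DS cardS cardSA]] := @common_indep_interpolation P Q A (I :\ i) J x.-1 mP mQ _ DJ.
- case/setIP: DI => PI QI; apply/setIP.
  by split; [apply: Psub PI sI | apply: Qsub QI sI].
- by rewrite cI.
- rewrite -[x.-1]subn1 leq_subLR; apply/andP; split; first by lia.
  apply: leq_trans lex _; rewrite (cardsD1 i) leq_add ?leq_b1 // subset_leq_card //.
  by apply/subsetP => e; rewrite !inE andbA.
by exists S => //; have := cardAB S; lia.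
Qed.
End Matroids.

(** * From [zeta] and [delta] to integer inequalities *)

Section Constants.
Import Order.TTheory GRing.Theory Num.Theory.
Local Open Scope ring_scope.
Variable T : finType.
Implicit Types (C P Q : {set {set T}}) (S A : {set T}).

Lemma zeta_ge C a S : zeta C = Some a -> S != set0 ->
  (0 < rank (restr C S))%N /\ #|S|%:R <= a * (rank (restr C S))%:R.
Proof.
rewrite /zeta; case: ifPn => // /existsPn noloop [<-] S0.
have := noloop S; rewrite S0 /= -lt0n => r_gt0; split=> //.
rewrite -ler_pdivrMr ?ltr0n //.
exact: (le_bigmax_cond 0 (fun S : {set T} => #|S|%:R / (rank (restr C S))%:R)).
Qed.

Lemma uniform_point P Q : let z := zeta_max (zeta P) (zeta Q) in
  exists k : nat, [/\ delta z #|T| * #|T|%:R <= k%:R,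
    forall S, (k * #|S| <= #|T| * rank (restr P S))%N
  & forall S, (k * #|S| <= #|T| * rank (restr Q S))%N].
Proof.
have [T0 | T_gt0] := posnP #|T|.
  exists 0%N; split=> [|S|S]; by rewrite ?T0 ?mulr0.
have n_gt0 : 0 < #|T|%:R :> rat by rewrite ltr0n.
(* For infinite [zeta], [delta] times [#|T|] is -1, so [k = 0] serves. *)
have zero : delta None #|T| * #|T|%:R <= 0%:R :> rat.
  by rewrite /delta /= sub0r mulNr mulVf ?gt_eqF // oppr_le0 ler01.
case zP: (zeta P) => [a|]; last by exists 0%N.
case zQ: (zeta Q) => [b|]; last by exists 0%N.
set c := Num.max a b => /=.
have setT0 : [set: T] != set0 by rewrite -card_gt0 cardsT.
have c_gt0 : 0 < c.
  rewrite lt_max; apply/orP; left.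
  have [r_gt0] := zeta_ge zP setT0; rewrite cardsT => /(lt_le_trans n_gt0).
  by rewrite pmulr_lgt0 ?ltr0n.
have nc_ge0 : 0 <= #|T|%:R / c by rewrite divr_ge0 ?ler0n ?ltW.
have [k /andP[kle klt]] : exists k : nat, k%:R <= #|T|%:R / c < k.+1%:R.
  by exists (Num.truncn (#|T|%:R / c)); apply: truncn_itv.
have bound C d : zeta C = Some d -> d <= c ->
    forall S, (k * #|S| <= #|T| * rank (restr C S))%N.
  move=> zC dc S; have [->|S0] := eqVneq S set0; first by rewrite cards0 muln0.
  have [r_gt0 Sd] := zeta_ge zC S0.
  rewrite -(ler_nat rat) !natrM.
  apply: le_trans (ler_wpM2l (ler0n _ _) Sd) _.
  rewrite mulrA ler_wpM2r ?ler0n //.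
  apply: le_trans (ler_wpM2l (ler0n _ _) dc) _.
  by rewrite -ler_pdivlMr.
exists k; split; last 2 first.
- by apply: bound zP _; rewrite le_max lexx.
- by apply: bound zQ _; rewrite le_max lexx orbT.
(* The term [1 / n] of [delta], times [n], is the 1 lost in rounding [n / c] down to [k]. *)
rewrite /delta /= mulrBl mulVf ?gt_eqF // mulrC lerBlDr.
by rewrite (le_trans (ltW klt)) // -natr1.
Qed.

Lemma almost_fair_divn alpha (k : nat) S A : alpha * #|T|%:R <= k%:R ->
  (k * #|A| %/ #|T| <= #|S :&: A|.+1)%N -> almost_fair alpha S A.
Proof.
move=> alk leS; rewrite /almost_fair lerBlDr.
apply: (@le_trans _ _ (k * #|A| %/ #|T|)%N%:Z).
  rewrite -ltzD1 floor_lt_int.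
  (* A nonempty [A] makes [#|T|] positive, so that it can be divided by. *)
  have [A0 | A_gt0] := posnP #|A|.
    by rewrite A0 mulr0 muln0 div0n.
  have T_gt0 : (0 < #|T|)%N := leq_trans A_gt0 (max_card A).
  have n_gt0 : 0 < #|T|%:R :> rat by rewrite ltr0n.
  rewrite -(ltr_pM2r n_gt0) mulrAC.
  apply: le_lt_trans (ler_wpM2r (ler0n _ _) alk) _.
  rewrite -PoszD -pmulrn -!natrM ltr_nat addn1.
  by rewrite -ltn_divLR.
by rewrite -PoszD lez_nat addn1.
Qed.
End Constants.

Theorem theorem2p7 (T : finType) (P Q : {set {set T}}) :
  is_matroid P -> is_matroid Q ->
  let D := P :&: Q in
  let n := #|T| in
  let z := zeta_max (zeta P) (zeta Q) in
  forall A B : {set T}, A :&: B = set0 -> A :|: B = [set: T] ->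
  exists2 S : {set T}, S \in D &
    almost_fair (delta z n) S A /\ almost_fair (delta z n) S B.
Proof.
move=> mP mQ D n z A B AB0 ABT.
have [k [zk kP kQ]] := uniform_point P Q.
have [S DS [SA SB]] := fair_common_indep mP mQ AB0 ABT kP kQ.
by exists S => //; split; apply: almost_fair_divn zk _.
Qed.
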